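(* Let $G=(V,A)$ be a finite digraph and $k\ge 1$ an integer. Given a circuit on $G$ that visits every vertex of $G$ at least once and at most $k$ times, a Hamiltonian cycle on $G^{2k-1}$ can be found in polynomial time (in particular, $G^{2k-1}$ is Hamiltonian).
   Context: A circuit on $G$ is a closed walk $v_1,\ldots,v_m,v_1$ with $\langle v_i,v_{i+1}\rangle\in A$ for $1\le i<m$ and $\langle v_m,v_1\rangle\in A$; vertices and arcs may be repeated. The number of times it visits a vertex $v$ is the number of indices $i\in\{1,\dots,m\}$ with $v_i=v$. For a positive integer $q$, $G^q$ is the digraph on $V$ having an arc $\langle u,v\rangle$ whenever $G$ contains a directed path from $u$ to $v$ with at most $q$ arcs. A Hamiltonian cycle in a digraph is an ordering $w_1,\dots,w_n$ of its vertices, each exactly once, such that $\langle w_i,w_{i+1}\rangle$ for $1\le i<n$ and $\langle w_n,w_1\rangle$ are all arcs (a digraph with a single vertex is regarded as trivially Hamiltonian). Polynomial time is with respect to the size of $G$ and of the circuit. *)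

(* Defs.v *)
From HB Require Import structures.
From mathcomp Require Import all_boot all_algebra.

Set Implicit Arguments.
Unset Strict Implicit.
Unset Printing Implicit Defensive.

(* A finite digraph is a finType V with an arbitrary arc relation A : rel V;   *)
(* loops are allowed.                                                          *)

Section Digraphs.

Variables (V : finType) (A : rel V).

(* [cycle] accepts the empty sequence, a circuit has at least one vertex.      *)
Definition circuit (c : seq V) : bool := (c != [::]) && cycle A c.

(* Paths are simple, in contrast with circuits; the path with no arc counts,   *)
(* so the power is reflexive.                                                  *)
Definition dipower (q : nat) : rel V := fun u v =>
  [exists l : 'I_q.+1, exists p : l.-tuple V,
    [&& path A u p, uniq (u :: p) & last u p == v]].

Definition hamiltonian_cycle (w : seq V) : bool :=
  perm_eq w (enum V) && ((#|V| == 1) || cycle A w).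

Definition hamiltonian : Prop := exists w : seq V, hamiltonian_cycle w.

Definition digraph_size : nat := #|V| + #|[set uv : V * V | A uv.1 uv.2]|.

Definition labels (s : seq V) : seq nat := [seq val (enum_rank v) | v <- s].

(* An instance is written as the number of vertices, the length of the         *)
(* circuit, the circuit, and the adjacency matrix in row-major order, vertices *)
(* being numbered from 0 to #|V| - 1.                                          *)
Definition encode (c : seq V) : seq nat :=
  [:: #|V|, size c & labels c ++
     [seq nat_of_bool (A u v) | u <- enum V, v <- enum V]].

End Digraphs.

(* The model of computation is the random access machine with addition and     *)
(* truncated subtraction (no multiplication), programmed with structured       *)
(* control and charged one unit per operation. Each operation adds at most one *)
(* bit to the largest value, so that after t steps values have t bits more     *)
(* than the inputs and program constants: polynomial time in this model is     *)
(* polynomial time on Turing machines (Cook and Reckhow, 1973).                *)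

Inductive expr : Type :=
  | Cst of nat
  | Reg of nat
  | Mem of expr
  | Add of expr & expr
  | Sub of expr & expr.

Inductive cmd : Type :=
  | Skip
  | SetReg of nat & expr
  | SetMem of expr & expr
  | Seq of cmd & cmd
  | If of expr & cmd & cmd
  | While of expr & cmd.

Record state : Type := State { regs : nat -> nat; mem : nat -> nat }.

Definition upd (f : nat -> nat) (a x : nat) : nat -> nat :=
  fun b => if b == a then x else f b.

Fixpoint eval (s : state) (e : expr) : nat :=
  match e with
  | Cst n => n
  | Reg r => regs s r
  | Mem e1 => mem s (eval s e1)
  | Add e1 e2 => eval s e1 + eval s e2
  | Sub e1 e2 => eval s e1 - eval s e2
  end.

Fixpoint ecost (e : expr) : nat :=
  match e with
  | Cst _ | Reg _ => 1
  | Mem e1 => (ecost e1).+1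
  | Add e1 e2 | Sub e1 e2 => (ecost e1 + ecost e2).+1
  end.

(* [exec P s t s']: started in s, the program P halts in s' after t steps.     *)
(* A guard is true when its value is nonzero.                                  *)
Inductive exec : cmd -> state -> nat -> state -> Prop :=
  | exec_Skip s : exec Skip s 1 s
  | exec_SetReg r e s :
      exec (SetReg r e) s (ecost e).+1
        (State (upd (regs s) r (eval s e)) (mem s))
  | exec_SetMem a e s :
      exec (SetMem a e) s (ecost a + ecost e).+1
        (State (regs s) (upd (mem s) (eval s a) (eval s e)))
  | exec_Seq P1 P2 s1 s2 s3 t1 t2 :
      exec P1 s1 t1 s2 -> exec P2 s2 t2 s3 ->
      exec (Seq P1 P2) s1 (t1 + t2) s3
  | exec_IfTrue e P1 P2 s t s' :
      eval s e != 0 -> exec P1 s t s' ->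
      exec (If e P1 P2) s (ecost e + t).+1 s'
  | exec_IfFalse e P1 P2 s t s' :
      eval s e == 0 -> exec P2 s t s' ->
      exec (If e P1 P2) s (ecost e + t).+1 s'
  | exec_WhileTrue e P s1 t1 s2 t2 s3 :
      eval s1 e != 0 -> exec P s1 t1 s2 -> exec (While e P) s2 t2 s3 ->
      exec (While e P) s1 (ecost e + t1 + t2).+1 s3
  | exec_WhileFalse e P s :
      eval s e == 0 -> exec (While e P) s (ecost e).+1 s.

(* Input and output are lists in memory, with their length in cell 0; all      *)
(* other cells and all registers are initially 0.                              *)
Definition init_state (x : seq nat) : state :=
  State (fun=> 0) (nth 0 (size x :: x)).

Definition output (s : state) : seq nat :=
  mkseq (fun i => mem s i.+1) (mem s 0).

Definition returns (P : cmd) (x : seq nat) (t : nat) (y : seq nat) : Prop :=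
  exists2 s : state, exec P (init_state x) t s & output s = y.

(* Main.v *)
Require Import Defs.
From mathcomp Require Import all_boot all_algebra zify.
(* [Mem], [Sub] and [mem] are to be those of the machine, not those of ssrbool *)
(* and eqtype.                                                                 *)
Import Defs.
Import GRing.Theory.

Set Implicit Arguments.
Unset Strict Implicit.
Unset Printing Implicit Defensive.

(* Cut the positions of the circuit into blocks of K consecutive positions,    *)
(* where K <= k is the largest number of visits. If every vertex chooses one   *)
(* of its occurrences and every block contains a chosen position, then         *)
(* consecutive chosen positions are, cyclically, at most 2K-1 arcs apart, and  *)
(* the vertices in the order of their chosen positions form the cycle. Such a  *)
(* choice is a matching covering the blocks, which exists by Hall's condition. *)
(* It is computed by an auction: while some block contains no chosen position, *)
(* its cheapest vertex moves its choice to that block and its price goes up by *)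
(* one. No price ever exceeds the number of vertices, so the sum of the prices *)
(* bounds the number of moves.                                                 *)

(** * Timed correctness of programs *)

(** Hall's condition holds by counting. Any [d] blocks contain more than [(d - 1) * K] positions, as
    only the last block can be short and it is nonempty; a vertex fills at most [K] positions, so at
    least [d] vertices occur in these blocks.

    In the auction, [inv_tight] is complementary slackness up to one unit: a vertex that has moved
    is at most one unit dearer than any vertex of its block. [price_lt] turns Hall's count into a
    bound on the prices, [inv_move] carries the invariant through a move, and [hamiltonian_of_hits]
    makes a Hamiltonian cycle of a choice that meets every block. On the machine side,
    [block_body_ok] shows that each round decreases a measure built on the sum of the prices, and
    [prog_ok] assembles the loops. *)

Definition runs (P : cmd) (s : state) (T : nat) (Q : state -> Prop) : Prop :=
  exists t s', [/\ exec P s t s', t <= T & Q s'].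

(* [wp] and [cost] are meant for programs without loops only. *)
Fixpoint wp (P : cmd) (Q : state -> Prop) (s : state) : Prop :=
  match P with
  | Skip => Q s
  | SetReg r e => Q (State (upd (regs s) r (eval s e)) (mem s))
  | SetMem a e => Q (State (regs s) (upd (mem s) (eval s a) (eval s e)))
  | Seq P1 P2 => wp P1 (wp P2 Q) s
  | If e P1 P2 => if eval s e != 0 then wp P1 Q s else wp P2 Q s
  | While _ _ => False
  end.

Fixpoint cost (P : cmd) : nat :=
  match P with
  | Skip => 1
  | SetReg _ e => (ecost e).+1
  | SetMem a e => (ecost a + ecost e).+1
  | Seq P1 P2 => cost P1 + cost P2
  | If e P1 P2 => (ecost e + maxn (cost P1) (cost P2)).+1
  | While _ _ => 0
  end.

Lemma runs_weaken P s T T' (Q Q' : state -> Prop) :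
  T <= T' -> (forall s', Q s' -> Q' s') -> runs P s T Q -> runs P s T' Q'.
Proof.
move=> leT QQ' [t [s' [ex le_t Qs']]].
by exists t, s'; split; [|exact: leq_trans le_t leT|exact: QQ'].
Qed.

Lemma runs_seq P1 P2 s T1 T2 Q :
  runs P1 s T1 (fun s1 => runs P2 s1 T2 Q) -> runs (Seq P1 P2) s (T1 + T2) Q.
Proof.
move=> [t1 [s1 [ex1 le1 [t2 [s2 [ex2 le2 Q2]]]]]].
by exists (t1 + t2), s2; split; [exact: exec_Seq ex1 ex2|exact: leq_add|].
Qed.

Lemma wp_runs P Q s : wp P Q s -> runs P s (cost P) Q.
Proof.
elim: P Q s => [|r e|a e|P1 IH1 P2 IH2|e P1 IH1 P2 IH2|e P _] Q s //=.
- by move=> Qs; exists 1, s; split=> //; constructor.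
- by move=> Qs; eexists; eexists; split; [constructor| |exact: Qs].
- by move=> Qs; eexists; eexists; split; [constructor| |exact: Qs].
- move=> H; apply: runs_seq; apply: runs_weaken (IH1 _ _ H) => // s1.
  exact: IH2.
case: ifP => [cT /IH1|/negbFE cF /IH2] [t [s' [ex le_t Qs']]].
- exists (ecost e + t).+1, s'; split=> //; first exact: exec_IfTrue.
  by rewrite ltnS leq_add2l leq_max le_t.
- exists (ecost e + t).+1, s'; split=> //; first exact: exec_IfFalse.
  by rewrite ltnS leq_add2l leq_max le_t orbT.
Qed.

(** The measure [mu] bounds the number of iterations, each charged for guard, body and one unit; the
    last summand pays for the failing guard. *)
Lemma runs_while e P (I : state -> Prop) (mu : state -> nat) T :
    (forall s, I s -> eval s e != 0 ->
       runs P s T (fun s' => I s' /\ mu s' < mu s)) ->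
  forall s, I s ->
  runs (While e P) s (mu s * (ecost e + T).+1 + (ecost e).+1)
    (fun s' => I s' /\ eval s' e = 0).
Proof.
move=> body s; move: {2}(mu s).+1 (ltnSn (mu s)) => N.
elim: N s => // N IH s ltN Is.
have [e0|eN0] := eqVneq (eval s e) 0.
  exists (ecost e).+1, s; split; [|exact: leq_addl|by []].
  by apply: exec_WhileFalse; rewrite e0.
have [t1 [s1 [ex1 le1 [Is1 lt1]]]] := body s Is eN0.
have [t2 [s2 [ex2 le2 H2]]] := IH s1 (leq_trans lt1 ltN) Is1.
exists (ecost e + t1 + t2).+1, s2; split=> //.
  exact: exec_WhileTrue ex1 ex2.
nia.
Qed.

(** * The auction *)

Section Blocks.

Variables (x : seq nat) (n K : nat).
Hypotheses (K_gt0 : 0 < K) (x_lt : forall v, v \in x -> v < n).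
Hypothesis count_le : forall v, count_mem v x <= K.

Let m := size x.
Notation x_ i := (nth 0 x i).

Lemma divn_block b i : (i %/ K == b) = (b * K <= i < b * K + K).
Proof. by rewrite eqn_leq -ltnS ltn_divLR // leq_divRL // mulSnr andbC. Qed.

(** Once [size D] is read as the number of [b < N] in [D], induction on [N] adds one full block of
    [K] positions at a time. *)
Lemma count_blocks D N : uniq D -> (forall b, b \in D -> b < N) ->
  count (fun i => i %/ K \in D) (iota 0 (N * K)) = size D * K.
Proof.
move=> uD ltD.
have -> : size D = count (fun b => b \in D) (iota 0 N).
  rewrite -size_filter; apply: perm_size; apply: uniq_perm => //.
    exact: filter_uniq (iota_uniq _ _).
  move=> b; rewrite mem_filter mem_iota add0n /=.
  by case bD: (b \in D) => //=; rewrite ltD.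
elim: N {ltD} => // N IH.
rewrite mulSnr iotaD count_cat IH -addn1 iotaD count_cat mulnDl /= add0n addn0.
congr (_ + _).
rewrite (@eq_in_count _ _ (fun=> N \in D)) => [|i].
  by case: (N \in D); rewrite ?count_predT ?count_pred0 ?size_iota ?mul1n.
by rewrite mem_iota -divn_block => /eqP ->.
Qed.

Lemma count_mem_le U : count (fun v => v \in U) x <= size U * K.
Proof.
elim: U => [|u U IH]; first by rewrite count_pred0.
rewrite mulSn; apply: leq_trans (leq_add (count_le u) IH).
rewrite -count_predUI; apply: leq_trans (leq_addr _ _).
by apply: sub_count => v /=; rewrite inE.
Qed.

(* Only vertices of positive price have moved, each to a block containing no   *)
(* chosen position: hence [inv_inj].                                           *)
Record price_inv (pos price : nat -> nat) : Prop := PriceInv {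
  inv_pos v : v < n -> pos v < m /\ x_ (pos v) = v;
  inv_tight v i : v < n -> 0 < price v -> i < m -> i %/ K = pos v %/ K ->
    price v <= (price (x_ i)).+1;
  inv_inj u v : u < n -> v < n -> 0 < price u -> 0 < price v ->
    pos u %/ K = pos v %/ K -> u = v;
  inv_le v : v < n -> price v <= n }.

Lemma ltn_x i : i < m -> x_ i < n.
Proof. by move=> ltim; apply: x_lt; rewrite mem_nth. Qed.

Section Move.

Variables (pos price : nat -> nat) (i : nat).
Hypothesis pp : price_inv pos price.
Hypothesis lt_im : i < m.
Hypothesis unhit : forall j, j < m -> j %/ K = i %/ K -> pos (x_ j) != j.
Hypothesis price_min :
  forall j, j < m -> j %/ K = i %/ K -> price (x_ i) <= price (x_ j).

Lemma unhit_pos v : v < n -> pos v %/ K <> i %/ K.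
Proof.
move=> ltv E; have [ltp xp] := inv_pos pp ltv.
by have := unhit ltp E; rewrite xp eqxx.
Qed.

(* If all prices in the block were at least [n], some level [l < n] would be  *)
(* the price of no vertex. The vertices priced above [l] then contain all     *)
(* vertices of the blocks they are assigned to, and those of the block of     *)
(* [i]: one block too many for their number of occurrences.                   *)
Lemma price_lt : price (x_ i) < n.
Proof.
rewrite ltnNge; apply/negP => le_n.
have ltv := ltn_x lt_im; set v := x_ i in le_n ltv.
(* Pigeonhole: the [n - 1] vertices other than [v] cannot take all [n] levels below [n], and [v]
   itself is priced above them. *)
have [l lt_ln lP] : exists2 l, l < n & forall u, u < n -> price u != l.
  have [/allP sub|/allPn[l]] := boolP
      (all (fun l => l \in [seq price u | u <- rem v (iota 0 n)]) (iota 0 n)).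
    have := uniq_leq_size (iota_uniq 0 n) sub.
    rewrite size_map size_rem ?mem_iota // size_iota.
    by case: (n) ltv => // n' _; rewrite ltnn.
  rewrite mem_iota /= add0n => lt_ln /mapP lP; exists l => // u ltu.
  apply/eqP => E; apply: lP; exists u => //.
  rewrite mem_rem_uniq ?iota_uniq // inE mem_iota add0n ltu leq0n !andbT.
  by apply/eqP => uv; move: lt_ln; rewrite -E [u]uv ltnNge le_n.
set U := [seq u <- iota 0 n | l < price u].
have memU u : (u \in U) = (l < price u) && (u < n) by rewrite mem_filter mem_iota.
set D := i %/ K :: [seq pos u %/ K | u <- U].
have uD : uniq D.
  rewrite /= map_inj_in_uniq ?filter_uniq ?iota_uniq ?andbT //.
    apply/negP => /mapP [u]; rewrite memU => /andP[_ ltu] E.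
    exact: (unhit_pos ltu).
  move=> u w; rewrite !memU => /andP[lu ltu] /andP[lw ltw].
  by apply: (inv_inj pp) => //; apply: leq_ltn_trans lu || apply: leq_ltn_trans lw.
(* [N] is the number of blocks; rounding [m] up to [N * K] adds fewer than [K] fictitious positions,
   which cannot make up for a whole block. *)
set N := (m.-1 %/ K).+1.
have ltN j : j < m -> j %/ K < N by move=> ltj; rewrite ltnS leq_div2r //; lia.
have ltD b : b \in D -> b < N.
  rewrite inE => /predU1P[->|/mapP[u]]; first exact: ltN.
  by rewrite memU => /andP[_ ltu] ->; apply: ltN; case: (inv_pos pp ltu).
have := count_blocks uD ltD.
have leNm : N * K < m + K.
  have := leq_divM m.-1 K; rewrite /N mulSn; lia.
have lemN : m <= N * K.
  have := divn_eq m.-1 K; have := ltn_pmod m.-1 K_gt0; rewrite /N mulSn; lia.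
rewrite -(subnKC lemN) iotaD count_cat add0n /= size_map.
have := count_size (fun i => i %/ K \in D) (iota m (N * K - m)).
rewrite size_iota.
(* In the block of [i], minimality gives prices at least [n]; in the block of [u], tightness gives
   at least [l], and [l] itself is not a price. *)
have : count (fun i => i %/ K \in D) (iota 0 m) <= size U * K.
  apply: leq_trans (count_mem_le U).
  rewrite -(mkseq_nth 0 x) /mkseq count_map -!size_filter.
  apply: uniq_leq_size => [|j]; first exact: filter_uniq (iota_uniq _ _).
  rewrite !mem_filter mem_iota leq0n add0n /= => /andP[jD ltj].
  rewrite ltj andbT memU ltn_x // andbT.
  move: jD; rewrite inE => /predU1P[/(price_min ltj)|/mapP[u]].
    by apply: leq_trans; apply: leq_trans le_n.
  rewrite memU => /andP[lu ltu] E; have u0 := leq_ltn_trans (leq0n _) lu.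
  have := inv_tight pp ltu u0 ltj E.
  have := lP _ (ltn_x ltj); lia.
rewrite mulSn; clearbody m N; move: (N * K) (size U * K) leNm lemN => a b.
move: (count _ (iota 0 m)) (count _ (iota m _)) => c1 c2; clear; lia.
Qed.

(** The moved vertex is tight because it was cheapest in its block, the others because prices only
    rise; injectivity holds because no choice lay in that block. The functions are compared below
    [n] only, since they will be arrays in memory. *)
Lemma inv_move pos' price' :
    (forall v, v < n -> pos' v = upd pos (x_ i) i v) ->
    (forall v, v < n -> price' v = upd price (x_ i) (price (x_ i)).+1 v) ->
  price_inv pos' price'.
Proof.
move=> pos'E price'E.
have leP v : v < n -> price v <= price' v.
  by move=> ltv; rewrite price'E // /upd; case: eqP => // ->.
split.
- move=> v ltv; rewrite pos'E // /upd; case: eqP => [->|_]; first by [].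
  exact: (inv_pos pp).
- move=> v j ltv; rewrite pos'E // price'E // /upd; case: eqP => [_ _|_ v0] ltj E.
    by rewrite ltnS; apply: leq_trans (price_min ltj E) (leP _ (ltn_x ltj)).
  apply: leq_trans (inv_tight pp ltv v0 ltj E) _.
  by rewrite ltnS; apply: leP; apply: ltn_x.
- move=> u v ltu ltv; rewrite !pos'E // !price'E // /upd.
  case: eqP => [->|_]; case: eqP => [->|_] // u0 v0 E.
  + by case: (unhit_pos ltv).
  + by case: (unhit_pos ltu).
  + exact: (inv_inj pp).
- move=> v ltv; rewrite price'E // /upd; case: eqP => _; last exact: (inv_le pp).
  exact: price_lt.
Qed.

End Move.

End Blocks.

(** * From chosen positions to the Hamiltonian cycle *)

Section Walks.

Variables (V : finType) (A : rel V).

(** A walk shortens to a simple path whose vertices are among those of the walk, hence with no more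
    arcs. *)
Lemma dipower_path q u p : path A u p -> size p <= q -> dipower A q u (last u p).
Proof.
case/shortenP => p' pp' up' sub_p' le_q.
have le_p' : size p' < q.+1.
  rewrite ltnS; apply: leq_trans le_q; apply: uniq_leq_size sub_p'.
  by case/andP: up'.
apply/existsP; exists (Ordinal le_p'); apply/existsP; exists (in_tuple p').
by rewrite pp' up' /=.
Qed.

Lemma sorted_between (r : rel nat) s : sorted ltn s ->
    {in s &, forall i j, i < j -> (forall h, h \in s -> ~~ (i < h < j)) -> r i j} ->
  sorted r s.
Proof.
elim: s => [|i [|j s] IH] //= /andP[ij sj] H.
apply/andP; split.
  apply: H; rewrite ?inE ?eqxx ?orbT // => h; rewrite !inE.
  case/or3P => [/eqP->|/eqP->|hs]; rewrite ?ltnn ?andbF //.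
  have := allP (order_path_min ltn_trans sj) _ hs; rewrite /= => jh.
  by rewrite [h < j]ltnNge (ltnW jh) andbF.
have sub : {subset j :: s <= i :: j :: s} by exact: (@mem_behead _ [:: i, j & s]).
apply: IH => // a b a_in b_in ab Hb; apply: (H _ _ (sub _ a_in) (sub _ b_in) ab).
move=> h; rewrite inE => /predU1P[->|/Hb //].
have ja : j <= a.
  move: a_in; rewrite inE => /predU1P[->//|as_].
  exact: ltnW (allP (order_path_min ltn_trans sj) _ as_).
by rewrite [a < i]ltnNge (leq_trans (ltnW ij) ja).
Qed.

Lemma path_ltn_last i s j : path ltn i s -> j \in i :: s -> j <= last i s.
Proof.
elim: s i j => [|k s IH] i j /=; first by rewrite inE => _ /eqP->.
case/andP => ik ps; rewrite inE => /predU1P[->|]; last exact: IH.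
by apply: leq_trans (ltnW ik) _; apply: IH => //; exact: mem_head.
Qed.

(** If the next chosen position after [i] were at least [i + 2 * K], the block of [i + K] would lie
    strictly between them, yet it contains a chosen position. For the closing arc, the first chosen
    position is below [K] and the last at least [m - K]. *)
Lemma hamiltonian_of_hits (c : seq V) (v0 : V) (K q : nat) (p : V -> nat) :
    0 < K -> 2 * K - 1 <= q -> circuit A c ->
    (forall v, p v < size c /\ nth v0 c (p v) = v) ->
    (forall j, j < size c ->
       exists2 i, i %/ K = j %/ K & i < size c /\ p (nth v0 c i) = i) ->
  hamiltonian_cycle (dipower A q)
    [seq nth v0 c i | i <- iota 0 (size c) & p (nth v0 c i) == i].
Proof.
move=> K0 le_q /andP[c0 cA] pP hit; set m := size c.
have m0 : 0 < m by rewrite /m; case: (c) c0.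
set I := filter _ _.
have memI i : (i \in I) = (p (nth v0 c i) == i) && (i < m).
  by rewrite mem_filter mem_iota.
have sI : sorted ltn I by apply: sorted_filter; [exact: ltn_trans|exact: iota_ltn_sorted].
have uI : uniq I by apply: filter_uniq; exact: iota_uniq.
apply/andP; split.
  apply: uniq_perm; rewrite ?enum_uniq //.
    rewrite map_inj_in_uniq // => i j; rewrite !memI.
    by move=> /andP[/eqP pi _] /andP[/eqP pj _] E; rewrite -pi -pj E.
  move=> v; rewrite mem_enum inE; apply/mapP; exists (p v); last by case: (pP v).
  by rewrite memI; case: (pP v) => -> ->; rewrite eqxx.
(* Extending the circuit periodically makes the closing arc a forward walk like the others. *)
pose f i := nth v0 c (i %% m).
have step i : A (f i) (f i.+1).
  rewrite /f -addn1 -modnDml addn1; have: i %% m < m by rewrite ltn_pmod.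
  move: (i %% m) => j; rewrite /m; case: (c) cA => //= y c' /(pathP v0) H.
  rewrite ltnS => le_j; have := H j; rewrite size_rcons ltnS => /(_ le_j).
  rewrite -rcons_cons nth_rcons /= ltnS le_j nth_rcons.
  case: ltngtP le_j => // [lt_j|->] _; first by rewrite modn_small.
  by rewrite modnn.
have walk i d : d <= q -> dipower A q (f i) (f (i + d)).
  move=> le_d.
  have [P lP] : path A (f i) [seq f j | j <- iota i.+1 d]
             /\ last (f i) [seq f j | j <- iota i.+1 d] = f (i + d).
    elim: d i {le_d} => [|d IH] i /=; first by rewrite addn0.
    by have [-> ->] := IH i.+1; rewrite step addSnnS.
  by rewrite -lP; apply: dipower_path; rewrite // size_map size_iota.
have fE i : i < m -> f i = nth v0 c i by move=> lti; rewrite /f modn_small.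
have ltI i : i \in I -> i < m by rewrite memI => /andP[].
have hitI j : j < m -> exists2 i, i \in I & j %/ K * K <= i < j %/ K * K + K.
  move=> /hit[i E [lti pi]]; exists i; first by rewrite memI pi eqxx.
  by rewrite -divn_block // E.
apply/orP; right.
have -> : [seq nth v0 c i | i <- I] = [seq f i | i <- I].
  by apply/eq_in_map => i /ltI /fE ->.
have srt : sorted (relpre f (dipower A q)) I.
  apply: sorted_between => // i j iI jI ij btw /=.
  rewrite -(subnKC (ltnW ij)); apply: walk; rewrite leqNgt; apply/negP => far.
  have lt_iK : i + K < m by have := ltI _ jI; lia.
  have [h hI] := hitI _ lt_iK.
  have /negP := btw h hI.
  rewrite divnDr ?dvdnn // divnn K0 mulnDl mul1n.
  have := leq_divM i K; have := ltn_ceil i K0; rewrite mulSn.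
  lia.
have [i1 i1I Hi1] := hitI 0 m0.
have [i2 i2I Hi2] := hitI m.-1 (ltac:(by rewrite prednK)).
have {}i1I : forall i0 I', I = i0 :: I' -> i0 < K.
  move=> i0 I' E; move: sI i1I; rewrite E /= => /(order_path_min ltn_trans)/allP min.
  move: Hi1; rewrite div0n mul0n add0n /= inE => lt_i1 /predU1P[<- //|/min /=].
  by move=> lt_i01; apply: ltn_trans lt_i01 lt_i1.
have {}i2I : forall i0 I', I = i0 :: I' -> m <= last i0 I' + K.
  move=> i0 I' E.
  have le_last : i2 <= last i0 I'.
    by move: sI i2I; rewrite E; exact: path_ltn_last.
  have := ltn_ceil m.-1 K0; rewrite mulSn; lia.
case: I ltI srt i1I i2I {memI sI uI hitI Hi1 Hi2 i2} => //= i0 I' ltI srt i1I i2I.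
rewrite rcons_path; apply/andP; split; first by rewrite path_map.
rewrite last_map.
have lt_l : last i0 I' < m by apply: ltI; exact: mem_last.
(* The first chosen position is reached again one turn later, at [i0 + m]. *)
have -> : f i0 = f (last i0 I' + (i0 + m - last i0 I')).
  by rewrite subnKC ?/f ?modnDr //; lia.
have := i1I _ _ erefl; have := i2I _ _ erefl.
by move=> ? ?; apply: walk; lia.
Qed.

End Walks.

(** * The program *)

(** Under truncated subtraction this is the absolute difference. *)
Definition Neq (a b : expr) : expr := Add (Sub a b) (Sub b a).

(** [rK] is the block length, [rS] and [rEnd] delimit the current block, [rHit] records a chosen
    position in it, [rBest] is a position of its cheapest vertex, and [rJ] is the length of the
    output so far. *)
Definition rN := Reg 0.
Definition rM := Reg 1.
Definition rB := Reg 2.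
Definition rI := Reg 3.
Definition rK := Reg 4.
Definition rS := Reg 5.
Definition rHit := Reg 6.
Definition rBest := Reg 7.
Definition rEnd := Reg 8.
Definition rJ := Reg 9.
Definition rV := Reg 10.

(** Cells 0, 1 and 2 hold the input length, the number of vertices and the circuit length. *)
Definition aX (e : expr) : expr := Add e (Cst 3).
(* Three arrays indexed by the vertices follow the input, which ends before    *)
(* address [rB].                                                               *)
Definition aCnt (v : expr) : expr := Add rB v.
Definition aPos (v : expr) : expr := Add (Add rB rN) v.
Definition aPrice (v : expr) : expr := Add (Add (Add rB rN) rN) v.
Definition X (e : expr) : expr := Mem (aX e).

Definition next_i : cmd := SetReg 3 (Add rI (Cst 1)).

(** The bound [k] is not part of the input: the block length is the largest number of visits, found
    here. Each vertex initially chooses its last occurrence. *)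
Definition count_body : cmd :=
  Seq (SetReg 10 (X rI))
 (Seq (SetMem (aCnt rV) (Add (Mem (aCnt rV)) (Cst 1)))
 (Seq (SetMem (aPos rV) rI)
 (Seq (If (Sub (Mem (aCnt rV)) rK) (SetReg 4 (Mem (aCnt rV))) Skip)
  next_i))).

Definition scan_body : cmd :=
  Seq (SetReg 10 (X rI))
 (Seq (If (Neq (Mem (aPos rV)) rI) Skip (SetReg 6 (Cst 1)))
 (Seq (If (Sub (Mem (aPrice (X rBest))) (Mem (aPrice rV)))
         (SetReg 7 rI) Skip)
  next_i)).

(** The search restarts from 0, as the move may leave an earlier block without a chosen position. *)
Definition move_best : cmd :=
  Seq (SetReg 10 (X rBest))
 (Seq (SetMem (aPos rV) rBest)
 (Seq (SetMem (aPrice rV) (Add (Mem (aPrice rV)) (Cst 1)))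
      (SetReg 5 (Cst 0)))).

(* The upper end of the block is [minn m (s + K)]. *)
Definition block_init : cmd :=
  Seq (SetReg 6 (Cst 0))
 (Seq (SetReg 7 rS)
 (Seq (SetReg 3 rS)
      (SetReg 8 (Sub rM (Sub rM (Add rS rK)))))).

Definition block_body : cmd :=
  Seq block_init
 (Seq (While (Sub rEnd rI) scan_body)
      (If rHit (SetReg 5 (Add rS rK)) move_best)).

(* The output overwrites the circuit, but only in cells already read: [j <= i] *)
(* entries have been written when entry [i], in cell [i + 3], is read.         *)
Definition output_body : cmd :=
  Seq (SetReg 10 (X rI))
 (Seq (If (Neq (Mem (aPos rV)) rI) Skip
         (Seq (SetMem (Add rJ (Cst 1)) rV) (SetReg 9 (Add rJ (Cst 1)))))
  next_i).

Definition load : cmd :=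
  Seq (SetReg 0 (Mem (Cst 1)))
 (Seq (SetReg 1 (Mem (Cst 2)))
      (SetReg 2 (Add (Mem (Cst 0)) (Cst 1)))).

Definition prog : cmd :=
  Seq load
 (Seq (While (Sub rM rI) count_body)
 (Seq (While (Sub rM rS) block_body)
 (Seq (SetReg 3 (Cst 0))
 (Seq (While (Sub rM rI) output_body)
      (SetMem (Cst 0) rJ))))).

Lemma upd_eq f a y : upd f a y a = y.
Proof. by rewrite /upd eqxx. Qed.

Lemma upd_neq f a y b : b != a -> upd f a y b = f b.
Proof. by rewrite /upd => /negbTE ->. Qed.

(** Unfolds [upd] at literal addresses only, so that memory writes at computed addresses stay
    folded. *)
Ltac rsimp := repeat (progress rewrite /=
  ?[upd _ 0 _ _]/upd ?[upd _ 1 _ _]/upd ?[upd _ 2 _ _]/upd ?[upd _ 3 _ _]/upd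
  ?[upd _ 4 _ _]/upd ?[upd _ 5 _ _]/upd ?[upd _ 6 _ _]/upd ?[upd _ 7 _ _]/upd
  ?[upd _ 8 _ _]/upd ?[upd _ 9 _ _]/upd ?[upd _ 10 _ _]/upd /=).

(** * Loop invariants and correctness of the program *)

Section Program.

Variables (x : seq nat) (n kk base : nat).
Hypotheses (x_lt : forall v, v \in x -> v < n).
Hypothesis count_x : forall v, v < n -> 0 < count_mem v x.
Hypothesis count_le : forall v, count_mem v x <= kk.
Notation m := (size x).
Hypotheses (m_gt0 : 0 < m) (lt_base : m + 3 <= base).
Notation x_ i := (nth 0 x i).

Definition cnt (M : nat -> nat) v := M (base + v).
Definition pos (M : nat -> nat) v := M (base + n + v).
Definition price (M : nat -> nat) v := M (base + n + n + v).

Definition frame (s : state) : Prop :=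
  [/\ regs s 0 = n, regs s 1 = m, regs s 2 = base
    & forall i, i < m -> mem s (i + 3) = x_ i].

Definition count_inv (s : state) : Prop :=
  let i := regs s 3 in
  [/\ frame s, i <= m, regs s 4 <= kk /\ regs s 5 = 0 /\ regs s 9 = 0,
      forall v, v < n ->
        cnt (mem s) v = count_mem v (take i x) /\ cnt (mem s) v <= regs s 4
    & forall v, v < n -> price (mem s) v = 0 /\
        (v \in take i x -> pos (mem s) v < m /\ x_ (pos (mem s) v) = v)].

Lemma count_body_ok s : count_inv s -> eval s (Sub rM rI) != 0 ->
  runs count_body s (cost count_body)
    (fun s' => count_inv s' /\ m - regs s' 3 < m - regs s 3).
Proof.
case: s => r M [[/= rn rm rb Mx] le_im [le_k r59] Hcnt Hp]; rewrite rm subn_eq0 -ltnNge.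
move=> lt_im; apply: wp_runs.
rsimp; rewrite rn rb Mx //.
have := ltn_x x_lt lt_im; set v := x_ (r 3) => lt_v.
set M' := upd _ (base + n + v) _.
have cntE w : w < n -> cnt M' w = count_mem w (take (r 3).+1 x).
  move=> lt_w; rewrite (take_nth 0) // -cats1 count_cat /= -/v addn0.
  have [cw _] := Hcnt w lt_w; rewrite -cw /cnt /M' /upd.
  have [->|/eqP neq] := eqVneq v w; first by rewrite eqxx; case: eqP => //; lia.
  by case: eqP => [|_]; [lia|case: eqP; lia].
have posE w : w < n -> pos M' w = if w == v then r 3 else pos M w.
  by move=> lt_w; rewrite /pos /M' /upd eqn_add2l; case: eqP => // _; case: eqP; lia.
have priceE w : price M' w = price M w.
  by rewrite /price /M' /upd; case: eqP => [|_]; [lia|case: eqP; lia].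
have le_cnt w : w < n -> M (base + w) <= r 4 by move=> /Hcnt [].
have cnt_old w : w < n -> w != v -> cnt M' w = cnt M w.
  by move=> lt_w /eqP neq; rewrite /cnt /M' /upd; case: eqP => [|_]; [lia|case: eqP; lia].
have cnt_new : cnt M' v = M (base + v) + 1.
  by rewrite /cnt /M' /upd; case: eqP => [|_]; [lia|rewrite eqxx].
(* Both branches of the conditional end with memory [M'] and differ only in register 4, so the
   invariant is proved once for all suitable registers. *)
have inv_r r' : r' 0 = r 0 -> r' 1 = r 1 -> r' 2 = r 2 -> r' 3 = r 3 + 1 ->
    r' 5 = r 5 -> r' 9 = r 9 -> r 4 <= r' 4 -> M' (base + v) <= r' 4 -> r' 4 <= kk ->
    count_inv (State r' M') /\ m - r' 3 < m - r 3.
  move=> e0 e1 e2 e3 e5 e9 le4 le4' le_kk; split; last by rewrite e3; lia.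
  rewrite /count_inv /frame /= e0 e1 e2 e3 e5 e9 addn1; split=> //.
  - split=> // i lt_i; rewrite -Mx // /M' /upd.
    by case: eqP => [|_]; [lia|case: eqP; lia].
  - move=> w lt_w; split; first exact: cntE.
    have [->//|neq] := eqVneq w v.
    by rewrite cnt_old //; apply: leq_trans le4; apply: le_cnt.
  move=> w lt_w; have [pw0 posw] := Hp w lt_w.
  rewrite priceE; split=> //.
  rewrite posE // (take_nth 0) // mem_rcons inE -/v.
  by have [->|neq /=] := eqVneq w v.
have le_kk : M' (base + v) <= kk.
  have := cntE v lt_v; rewrite /cnt => ->; apply: leq_trans (count_le v).
  by rewrite -[in leqRHS](cat_take_drop (r 3).+1 x) count_cat leq_addr.
case: ifP => [|/negbFE].
  by rewrite subn_eq0 -ltnNge => lt4; apply: inv_r; rsimp => //; exact: ltnW.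
by rewrite subn_eq0 => le4; apply: inv_r; rsimp.
Qed.

Definition hit (K : nat) (M : nat -> nat) (j : nat) : Prop :=
  exists2 i, i %/ K = j %/ K & i < m /\ pos M (x_ i) = i.

(** Here [r0] and [M] are the registers and memory at entry; the scan may change only registers 3,
    6, 7 and 10 among those of the program. *)
Definition scan_inv (r0 M : nat -> nat) (s : state) : Prop :=
  let S := r0 5 in let i := regs s 3 in let b := regs s 7 in
  [/\ (forall k, k \in [:: 0; 1; 2; 4; 5; 8; 9] -> regs s k = r0 k) /\ mem s = M,
      S <= i <= r0 8, S <= b < r0 8,
      forall j, S <= j < i -> price M (x_ b) <= price M (x_ j)
    & if regs s 6 == 0 then forall j, S <= j < i -> pos M (x_ j) != j
      else exists2 j, S <= j < i & pos M (x_ j) = j].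

Lemma scan_body_ok r0 M s : frame (State r0 M) -> r0 8 <= m -> scan_inv r0 M s ->
  eval s (Sub rEnd rI) != 0 ->
  runs scan_body s (cost scan_body)
    (fun s' => scan_inv r0 M s' /\ m - regs s' 3 < m - regs s 3).
Proof.
move=> [/= rn rm rb Mx] le_Em; case: s => r _ [/= [rE ->]].
have E k (kin : k \in [:: 0; 1; 2; 4; 5; 8; 9]) := rE k kin.
move=> /andP[leSi leiE] /andP[leSb ltbE] Hb Hh.
rewrite (E 8) // subn_eq0 -ltnNge => ltiE; apply: wp_runs; rsimp.
have lt_im : r 3 < m by lia.
have lt_bm : r 7 < m by lia.
rewrite (E 0) // (E 2) // rn rb !Mx //.
have mono r' : (forall k, k \in [:: 0; 1; 2; 4; 5; 8; 9] -> r' k = r k) ->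
    r' 3 = r 3 + 1 ->
    r' 7 = (if price M (x_ (r 7)) - price M (x_ (r 3)) != 0 then r 3 else r 7) ->
    r' 6 = (if pos M (x_ (r 3)) == r 3 then 1 else r 6) ->
    scan_inv r0 M (State r' M) /\ m - r' 3 < m - r 3.
  move=> r'E e3 e7 e6; split; last by rewrite e3; lia.
  split=> /=.
  - by split=> // k kin; rewrite r'E // E.
  - rewrite e3; lia.
  - by rewrite e7; case: ifP => _; lia.
  - move=> j; rewrite e3 addn1 ltnS [j <= _]leq_eqVlt => /andP[leSj].
    rewrite e7 => /predU1P[->|lt_ji]; first by case: ifP => //; lia.
    have := Hb j; rewrite leSj lt_ji => /(_ isT).
    by case: ifP => //; lia.
  rewrite e6 e3; case: (eqVneq (pos M (x_ (r 3))) (r 3)) => pi.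
    by rewrite /=; exists (r 3) => //; lia.
  move: Hh; case: ifP => _ Hh.
    move=> j; rewrite addn1 ltnS [j <= _]leq_eqVlt => /andP[leSj].
    by case/predU1P => [->//|lt_ji]; apply: Hh; rewrite leSj.
  by case: Hh => j /andP[leSj ltj] pj; exists j => //; lia.
rewrite -/(pos M _) -/(price M _) -/(price M _).
have -> : (pos M (x_ (r 3)) - r 3 + (r 3 - pos M (x_ (r 3))) != 0)
          = (pos M (x_ (r 3)) != r 3) by lia.
case: ifP => pT; rsimp; case: ifP => bT; apply: mono; rsimp.
all: rewrite ?bT ?(negbTE pT) ?(negbFE pT) // => k.
all: by rewrite !inE => /or4P[/eqP->|/eqP->|/eqP->|/or4P[/eqP->|/eqP->|/eqP->|/eqP->]].
Qed.

(** Divisibility of [regs s 5] by the block length makes the interval scanned next exactly one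
    block. *)
Definition block_inv (s : state) : Prop :=
  [/\ frame s, 0 < regs s 4 <= kk, regs s 9 = 0,
      (forall v, count_mem v x <= regs s 4) /\
      price_inv x n (regs s 4) (pos (mem s)) (price (mem s))
    & regs s 4 %| regs s 5 /\
      forall j, j < m -> j < regs s 5 -> hit (regs s 4) (mem s) j].

(** A lexicographic order in one number: a move raises the sum of prices by one, and the weight
    [m.+1] outweighs the reset of [rS]; otherwise only [rS] advances. *)
Definition block_measure (s : state) : nat :=
  (n * n - \sum_(v < n) price (mem s) v) * m.+1 + (m - regs s 5).

Definition block_time : nat :=
  cost block_init + (m * (ecost (Sub rEnd rI) + cost scan_body).+1
     + (ecost (Sub rEnd rI)).+1 + cost (If rHit (SetReg 5 (Add rS rK)) move_best)).

Lemma sum_price_le K p q : price_inv x n K p q -> \sum_(v < n) q v <= n * n.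
Proof.
move=> pq; have -> : n * n = \sum_(v < n) n by rewrite sum_nat_const card_ord.
by apply: leq_sum => v _; apply: (inv_le pq).
Qed.

Lemma sum_upd (q q' : nat -> nat) v : v < n ->
  (forall w, w < n -> q' w = upd q v (q v).+1 w) ->
  \sum_(w < n) q' w = (\sum_(w < n) q w).+1.
Proof.
move=> lt_v q'E.
rewrite (bigD1 (Ordinal lt_v)) //= [in RHS](bigD1 (Ordinal lt_v)) //=.
rewrite q'E // upd_eq addSn; congr (_ + _).+1.
by apply: eq_bigr => w neq; rewrite q'E // upd_neq.
Qed.

Lemma block_body_ok s : block_inv s -> eval s (Sub rM rS) != 0 ->
  runs block_body s block_time
    (fun s' => block_inv s' /\ block_measure s' < block_measure s).
Proof.
case: s => r M [fr /= /andP[K0 le_K] r9 [count_r4 pp] [dvS hS]].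
have [/= rn rm rb Mx] := fr; rewrite rm subn_eq0 -ltnNge => ltSm.
set r1 := upd (upd (upd (upd r 6 0) 7 (r 5)) 3 (r 5)) 8 (m - (m - (r 5 + r 4))).
have r1E k : k \in [:: 0; 1; 2; 4; 5; 9] -> r1 k = r k.
  by rewrite !inE => /or3P[/eqP->|/eqP->|/or4P[/eqP->|/eqP->|/eqP->|/eqP->]].
have r18 : r1 8 = m - (m - (r 5 + r 4)) by [].
apply: runs_seq.
apply: (@runs_weaken _ _ (cost block_init) _ (fun s => s = State r1 M)) => //;
  last first.
  by apply: wp_runs; rsimp; rewrite rm.
move=> _ ->; apply: runs_seq.
have fr1 : frame (State r1 M) by rewrite /frame /= !r1E.
have le8 : r1 8 <= m by rewrite r18; lia.
have scan0 : scan_inv r1 M (State r1 M).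
  rewrite /scan_inv /= !(r1E 5) // r18; split=> //.
  - have -> : r1 3 = r 5 by []. lia.
  - have -> : r1 7 = r 5 by []. lia.
  - by move=> j; have -> : r1 3 = r 5 by []; lia.
  - by move=> j; have -> : r1 3 = r 5 by []; lia.
have := runs_while (fun s Is => scan_body_ok fr1 le8 Is) scan0.
apply: runs_weaken; first by rewrite leq_add2r leq_mul2r leq_subr orbT.
case=> r2 _ [[/= [r2E ->] le_i le_b Hb Hh] /eqP].
rewrite subn_eq0 => le_Ei; apply: wp_runs; rsimp.
have e k : k \in [:: 0; 1; 2; 4; 5; 9] -> r2 k = r k.
  move=> kin; rewrite r2E ?r1E //; move: kin; rewrite !inE.
  by case/or3P => [->|->|/or4P[->|->|->|->]]; rewrite ?orbT.
have e8 := r2E 8 isT; rewrite r18 in e8.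
move: le_i le_b Hb Hh; rewrite !(r1E 5) // -(r2E 8) // e8 in le_Ei * => le_i le_b Hb Hh.
have blockE j : (j %/ r 4 == r 5 %/ r 4) = (r 5 <= j < r 5 + r 4).
  by rewrite divn_block // divnK.
have fr' r' M' : r' 0 = r 0 -> r' 1 = r 1 -> r' 2 = r 2 ->
    (forall i, i < m -> M' (i + 3) = M (i + 3)) -> frame (State r' M').
  by move=> E0 E1 E2 Mx'; split=> /= [|||i lt_i]; rewrite ?E0 ?E1 ?E2 ?Mx' ?Mx.
case: ifP => r6.
  split; last by rewrite /block_measure /= upd_eq !e // ltn_add2l; lia.
  move: Hh; rewrite (negbTE r6) => -[t le_t pt].
  split; rsimp; rewrite ?e ?K0 //; first by apply: fr'; rsimp; rewrite ?e.
  split; first exact: dvdn_add.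
  move=> j ltj lt_jS; have [lt_j|le_j] := ltnP j (r 5); first exact: hS.
  exists t; last by split=> //; lia.
  have /eqP -> : j %/ r 4 == r 5 %/ r 4 by rewrite blockE; lia.
  by apply/eqP; rewrite blockE; lia.
move: Hh; rewrite (negbFE r6) => Hh.
have lt_bm : r2 7 < m by lia.
have /eqP Eb : r2 7 %/ r 4 == r 5 %/ r 4 by rewrite blockE; lia.
rewrite (e 0) // (e 2) // rn rb Mx //; set v := x_ (r2 7).
have lt_v : v < n by exact: (ltn_x x_lt).
set M' := upd _ (base + n + n + v) _.
have Mx' i : i < m -> M' (i + 3) = M (i + 3).
  by move=> lt_i; rewrite /M' /upd; case: eqP => [|_]; [lia|case: eqP; lia].
have posE w : w < n -> pos M' w = upd (pos M) v (r2 7) w.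
  move=> lt_w; rewrite /pos /M' /upd eqn_add2l; case: eqP => //; lia.
have priceE w : w < n -> price M' w = upd (price M) v (price M v).+1 w.
  move=> lt_w; rewrite /price /M'; have [->|neq] := eqVneq w v.
    by rewrite !upd_eq upd_neq ?addn1 //; apply/eqP; lia.
  by rewrite !upd_neq //; move/eqP: neq => neq; apply/eqP; lia.
have unhit j : j < m -> j %/ r 4 = r2 7 %/ r 4 -> pos M (x_ j) != j.
  by move=> ltj /eqP; rewrite Eb blockE => Hj; apply: Hh; lia.
have pmin j : j < m -> j %/ r 4 = r2 7 %/ r 4 -> price M (x_ (r2 7)) <= price M (x_ j).
  by move=> ltj /eqP; rewrite Eb blockE => Hj; apply: Hb; lia.
have pp' : price_inv x n (r 4) (pos M') (price M').
  by apply: (inv_move K0 x_lt count_r4 pp lt_bm unhit pmin).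
split.
  split; rsimp; rewrite ?e ?K0 //; first by apply: fr'; rsimp; rewrite ?e.
(* The bound is taken after the move, so that the truncated difference really decreases. *)
have := sum_price_le pp'; rewrite /block_measure /= upd_eq (sum_upd lt_v priceE).
move: (\sum_(w < n) _) => Sp le_Sp.
have -> : n * n - Sp = (n * n - Sp.+1).+1 by lia.
by rewrite mulSn; lia.
Qed.

Definition chosen (p : nat -> nat) (i : nat) : seq nat :=
  [seq x_ t | t <- iota 0 i & p (x_ t) == t].

Definition output_inv (M : nat -> nat) (s : state) : Prop :=
  let i := regs s 3 in
  [/\ [/\ regs s 0 = n, regs s 1 = m & regs s 2 = base],
      regs s 9 <= i <= m,
      forall a, i + 3 <= a -> mem s a = M a
    & mkseq (fun t => mem s t.+1) (regs s 9) = chosen (pos M) i].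

Lemma output_body_ok M s : (forall i, i < m -> M (i + 3) = x_ i) ->
  output_inv M s -> eval s (Sub rM rI) != 0 ->
  runs output_body s (cost output_body)
    (fun s' => output_inv M s' /\ m - regs s' 3 < m - regs s 3).
Proof.
move=> Mx; case: s => r M' [/= [rn rm rb] /andP[le_ji le_im] ME LE].
rewrite rm subn_eq0 -ltnNge => lt_im; apply: wp_runs; rsimp.
rewrite rn rb (ME (r 3 + 3)) // Mx //; set v := x_ (r 3).
rewrite ME; last lia.
rewrite -/(pos M v).
have -> : (pos M v - r 3 + (r 3 - pos M v) != 0) = (pos M v != r 3) by lia.
have LS : chosen (pos M) (r 3).+1
          = chosen (pos M) (r 3) ++ (if pos M v == r 3 then [:: v] else [::]).
  rewrite /chosen -addn1 iotaD filter_cat map_cat add0n /= -/v.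
  by case: eqP.
case: ifP => [pN|/negbFE pE]; rsimp; (split; last lia);
  split; rsimp; rewrite ?addn1 ?LS ?pE ?(negbTE pN) ?cats0 //; try by lia.
- by move=> a le_a; apply: ME; lia.
- by move=> a le_a; rewrite upd_neq ?ME //; first lia; apply/eqP; lia.
rewrite mkseqS -LE cats1 upd_eq; congr (rcons _ _).
apply/eq_in_map => t; rewrite mem_iota add0n /= => lt_t.
by rewrite upd_neq // eqSS; apply/eqP; lia.
Qed.

Definition prog_time : nat :=
  cost load + (m * (ecost (Sub rM rI) + cost count_body).+1
    + (ecost (Sub rM rI)).+1
    + ((n * n * m.+1 + m) * (ecost (Sub rM rS) + block_time).+1
       + (ecost (Sub rM rS)).+1
       + (cost (SetReg 3 (Cst 0))
          + (m * (ecost (Sub rM rI) + cost output_body).+1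
             + (ecost (Sub rM rI)).+1 + cost (SetMem (Cst 0) rJ))))).

(** The witnesses are the block length and the choices in memory when the auction halts: then [rS]
    has passed the last position, so every block is hit. *)
Lemma prog_ok M0 :
    [/\ M0 0 + 1 = base, M0 1 = n & M0 2 = m] ->
    (forall i, i < m -> M0 (i + 3) = x_ i) ->
    (forall a, base <= a -> M0 a = 0) ->
  runs prog (State (fun=> 0) M0) prog_time (fun s => exists K p,
    [/\ 0 < K <= kk,
        forall v, v < n -> p v < m /\ x_ (p v) = v,
        forall j, j < m ->
          exists2 i, i %/ K = j %/ K & i < m /\ p (x_ i) = i
      & output s = chosen p m]).
Proof.
move=> [M00 M01 M02] M0x M00s.
apply: runs_seq; apply: (@runs_weaken _ _ (cost load) _ count_inv) => //; last first.
  apply: wp_runs; rsimp; rewrite M00 M01 M02; split; rsimp => //.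
  - by move=> v lt_v; rewrite take0 /cnt M00s ?leq_addr.
  - by move=> v lt_v; rewrite take0 /price M00s //; lia.
move=> [r M] [fr /= le3 [le4 [r5 r9]] Hcnt Hp].
have count0 : count_inv (State r M) by [].
apply: runs_seq; apply: runs_weaken (runs_while count_body_ok count0).
  by rewrite leq_add2r leq_mul2r leq_subr orbT.
move=> {r M fr le3 le4 r5 r9 Hcnt Hp count0}.
case=> r M [[fr /= le3 [le4 [r5 r9]] Hcnt Hp] /eqP].
have [/= rn rm rb Mx] := fr; rewrite rm subn_eq0 => ge3.
have e3 : r 3 = m by apply/eqP; rewrite eqn_leq le3 ge3.
have mem_x v : v < n -> v \in x by rewrite -has_pred1 has_count => /count_x.
move: Hcnt Hp; rewrite e3 take_size => Hcnt Hp.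
have count_r4 v : count_mem v x <= r 4.
  have [/x_lt lt_v|/count_memPn -> //] := boolP (v \in x).
  by have [<-] := Hcnt v lt_v.
have K0 : 0 < r 4.
  apply: leq_trans (count_r4 (x_ 0)); rewrite -has_count has_pred1.
  exact: mem_nth.
have block0 : block_inv (State r M).
  split; rewrite /= ?K0 //; last by rewrite r5; split.
  split=> //; split=> [v lt_v|v i lt_v|u v lt_u _|v lt_v].
  - by have [_] := Hp v lt_v; apply; apply: mem_x.
  - by have [->] := Hp v lt_v.
  - by have [->] := Hp u lt_u.
  - by have [->] := Hp v lt_v.
apply: runs_seq; apply: runs_weaken (runs_while block_body_ok block0).
  rewrite leq_add2r; apply: leq_mul => //; apply: leq_add; last exact: leq_subr.
  by apply: leq_mul => //; exact: leq_subr.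
move=> {r M fr le3 le4 r5 r9 Hcnt Hp block0 e3 ge3 count_r4 K0 rn rm rb Mx}.
case=> r M [[fr /= /andP[K0 le_K] r9 [_ pp] [_ hitS]] /eqP].
have [/= rn rm rb Mx] := fr; rewrite rm subn_eq0 => geS.
apply: runs_seq.
apply: (@runs_weaken _ _ (cost (SetReg 3 (Cst 0))) _ (output_inv M)) => //;
  last first.
  by apply: wp_runs; split; rsimp; rewrite ?r9.
move=> s out0.
apply: runs_seq; apply: runs_weaken (runs_while (fun s => output_body_ok Mx (s := s)) out0).
  by rewrite leq_add2r leq_mul2r leq_subr orbT.
move=> {s out0}; case=> r' M' [[/= [r'n r'm r'b] /andP[_ le3] _ LE] /eqP].
rewrite r'm subn_eq0 => ge3; have e3 : r' 3 = m by apply/eqP; rewrite eqn_leq le3 ge3.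
apply: wp_runs; exists (r 4), (pos M); split=> //.
- by rewrite K0.
- exact: (inv_pos pp).
- by move=> j lt_j; apply: hitS => //; apply: leq_trans geS.
by rewrite -e3 -LE /output /= upd_eq; apply: eq_mkseq => t; rewrite upd_neq.
Qed.

End Program.

(** * The polynomial time bound and the theorem *)

(** There are at most [(S + 1)^3] rounds of cost at most [150 * (S + 1)] each; doubling the constant
    absorbs the two linear loops and the remaining instructions. *)
Definition time_poly : {poly nat} :=
  (300%:P * (('X + 1%:P) * ('X + 1%:P)) * (('X + 1%:P) * ('X + 1%:P)))%R.

Lemma prog_time_le (x : seq nat) n S :
  n <= S -> size x <= S -> prog_time x n <= (time_poly.[S])%R.
Proof.
have -> : (time_poly.[S])%R = 300 * (S.+1 * S.+1) * (S.+1 * S.+1).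
  by rewrite /time_poly !hornerM hornerD hornerX !hornerC addrC.
move=> le_n le_m.
have le_block : (ecost (Sub rM rS) + block_time x).+1 <= 150 * S.+1.
  by rewrite /block_time /=; lia.
have le_iter : n * n * (size x).+1 + size x <= S.+1 * S.+1 * S.+1.
  have := leq_mul (leq_mul le_n le_n) (_ : (size x).+1 <= S.+1); lia.
have := leq_mul le_iter le_block; rewrite /prog_time.
have le_S : S.+1 <= S.+1 * S.+1 * S.+1 * S.+1 by rewrite leq_pmull // !muln_gt0.
rewrite !mulnA [_ * 150]mulnC !mulnA in le_S *.
move: (ecost (Sub rM rS) + block_time x).+1 => b.
move: (_ * b) => u; move: (S.+1 * S.+1 * S.+1 * S.+1) le_S => v le_S.
rewrite /=; lia.
Qed.

Lemma count_labels (V : finType) (c : seq V) (v : V) :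
  count_mem (val (enum_rank v)) (labels c) = count_mem v c.
Proof.
rewrite /labels count_map; apply: eq_count => u /=.
by rewrite (inj_eq val_inj) (inj_eq enum_rank_inj).
Qed.

Theorem lemma3 :
  (exists (P : cmd) (p : {poly nat}),
     forall (V : finType) (A : rel V) (k : nat) (c : seq V),
       1 <= k -> circuit A c -> (forall v : V, 1 <= count_mem v c <= k) ->
       exists (t : nat) (w : seq V),
         [/\ returns P (encode A c) t (labels w),
             t <= (p.[(digraph_size A + size c)%N])%R
           & hamiltonian_cycle (dipower A (2 * k - 1)) w])
  /\
  (forall (V : finType) (A : rel V) (k : nat) (c : seq V),
     1 <= k -> circuit A c -> (forall v : V, 1 <= count_mem v c <= k) ->
     hamiltonian (dipower A (2 * k - 1))).
Proof.
suff alg : exists (P : cmd) (p : {poly nat}),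
     forall (V : finType) (A : rel V) (k : nat) (c : seq V),
       1 <= k -> circuit A c -> (forall v : V, 1 <= count_mem v c <= k) ->
       exists (t : nat) (w : seq V),
         [/\ returns P (encode A c) t (labels w),
             t <= (p.[(digraph_size A + size c)%N])%R
           & hamiltonian_cycle (dipower A (2 * k - 1)) w].
  split=> // V A k c k0 cA ck; have [P [p algP]] := alg.
  by have [t [w [_ _ hw]]] := algP V A k c k0 cA ck; exists w.
exists prog, time_poly => V A k c k_gt0 cA count_c.
have [v0 m_gt0] : exists v0 : V, 0 < size c.
  by case/andP: cA; case: c {count_c} => // v0 c _ _; exists v0.
set x := labels c.
have size_x : size x = size c by rewrite size_map.
have x_lt v : v \in x -> v < #|V| by case/mapP => u _ ->; exact: ltn_ord.
have rankP v : v < #|V| -> exists u : V, v = val (enum_rank u).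
  by move=> lt_v; exists (enum_val (Ordinal lt_v)); rewrite enum_valK.
have count_gt0 v : v < #|V| -> 0 < count_mem v x.
  by case/rankP => u ->; rewrite count_labels; case/andP: (count_c u).
have count_le v : count_mem v x <= k.
  have [/x_lt /rankP[u ->]|/count_memPn -> //] := boolP (v \in x).
  by rewrite count_labels; case/andP: (count_c u).
set e := encode A c; set base := (size e).+1.
have lt_base : size x + 3 <= base.
  by rewrite /base /e /encode /= size_cat -/x; lia.
have m_gt0' : 0 < size x by rewrite size_x.
have [|i lt_i|a le_a|t [s [ex le_t [K [p [/andP[K0 le_K] pP hitP out]]]]]] :=
    prog_ok x_lt count_gt0 count_le m_gt0' lt_base (M0 := nth 0 (size e :: e)).
- by split; rewrite /= ?addn1 ?size_x.
- by rewrite addn3 /e /encode /= -/x nth_cat lt_i.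
- by rewrite nth_default.
pose q (v : V) := p (val (enum_rank v)).
have x_E i : i < size c -> nth 0 x i = val (enum_rank (nth v0 c i)).
  by move=> lt_i; rewrite /x /labels (nth_map v0).
exists t, [seq nth v0 c i | i <- iota 0 (size c) & q (nth v0 c i) == i]; split.
- exists s => //; rewrite out /chosen size_x /labels -map_comp.
  have -> : [seq i <- iota 0 (size c) | p (nth 0 x i) == i]
            = [seq i <- iota 0 (size c) | q (nth v0 c i) == i].
    by apply: eq_in_filter => i; rewrite mem_iota add0n /= => lt_i; rewrite x_E.
  apply/eq_in_map => i; rewrite mem_filter mem_iota => /andP[_ /= lt_i].
  exact: x_E.
- apply: leq_trans le_t _; apply: prog_time_le.
    by rewrite /digraph_size -addnA leq_addr.
  by rewrite size_x leq_addl.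
(* The program works with [K <= k], whence [2 * K - 1 <= 2 * k - 1]. *)
apply: (hamiltonian_of_hits K0 _ cA); first by lia.
- move=> v; have [lt_p xp] := pP _ (ltn_ord (enum_rank v)).
  rewrite -size_x; split=> //; apply: enum_rank_inj; apply: val_inj => /=.
  by rewrite -[RHS]xp x_E // -size_x.
move=> j; rewrite -size_x => /hitP[i E [lt_i pi]]; exists i => //.
by split=> //; rewrite /q -x_E // -size_x.
Qed.
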